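(* Let $\ell>0$, let $a,b>0$ be constants, let $f$ be a continuous function on $[0,\ell]$, and let $w$ be the solution of the boundary value problem $$a\,w(x)-b\,w''(x)=f(x),\quad x\in[0,\ell],\qquad w(0)=w(\ell)=0.$$ Suppose $w\in C^{p+1}([0,\ell])$ with an integer $p\ge1$. Let $w_N(x)=a_1\phi_1(x)+a_2\phi_2(x)+\dots+a_N\phi_N(x)$, where the coefficients $a_m$ $(m=1,\dots,N)$ are determined by solving the Ritz–Galerkin system for this problem with basis functions $\phi_1,\dots,\phi_N$ given in the context. Then there is a constant $c>0$, independent of $N$, such that $$\|w_N-w\|\le\frac{c}{N^{p-1/2}}.$$
   Context: $\|\cdot\|$ and $(\cdot,\cdot)$ are the norm and inner product of $L^2(0,\ell)$. In the application, $(a,b)=(1,\tau^2q_{k,N}/2)$ or $(a,b)=(1+\tau^2\delta/2,\tau^2\gamma/2)$ with $\tau,q_{k,N},\gamma,\delta>0$. Basis functions: let $P_m$ be the standard Legendre polynomial of degree $m$ on $[-1,1]$, $\widetilde P_m(x)=P_m\left(\frac{2x}{\ell}-1\right)$, $A_m=1/\sqrt{2m+1}$, and $\widehat P_m(x)=\frac{1}{A_m\sqrt\ell}\widetilde P_m(x)$ the orthonormal shifted Legendre polynomial on $[0,\ell]$. Then $\phi_m(x)=\int_0^x\widehat P_m(s)\,ds$, $m=1,2,\dots$. Ritz–Galerkin system: the linear system $b\,(w_N',\phi_m')+a\,(w_N,\phi_m)=(f,\phi_m)$, $m=1,\dots,N$, for the coefficients of $w_N$; equivalently $w_N$ minimizes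 $I(w)=\int_0^\ell\left(b\,w'^2+a\,w^2-2fw\right)dx$ over the span of $\phi_1,\dots,\phi_N$. *)

(* Defs.v *)
From Stdlib Require Import Reals.
From Coquelicot Require Import Coquelicot.
Open Scope R_scope.

(* Functions on [0, l] are represented by total functions R -> R whose values
   outside [0, l] are irrelevant. *)

Definition segm (l : R) (x : R) : Prop := 0 <= x <= l.

Definition continuous_on_segm (l : R) (f : R -> R) : Prop :=
  forall x, segm l x -> continue_in f (segm l) x.

(* Difference quotients only use points of [0, l], so that the derivatives at
   0 and l are one-sided. *)
Definition is_derivative_on_segm (l : R) (f g : R -> R) : Prop :=
  forall x, segm l x -> D_in f g (segm l) x.

Fixpoint of_class_C (l : R) (k : nat) (f : R -> R) : Prop :=
  match k with
  | O => continuous_on_segm l f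
  | S k' => exists g, is_derivative_on_segm l f g /\ of_class_C l k' g
  end.

(* All functions these are applied to are continuous on [0, l], so the Riemann
   integral agrees with the Lebesgue integral defining L^2(0, l). *)
Definition inner_L2 (l : R) (u v : R -> R) : R := RInt (fun x => u x * v x) 0 l.

Definition norm_L2 (l : R) (u : R -> R) : R := sqrt (inner_L2 l u u).

Definition solves_bvp (l a b : R) (f w : R -> R) : Prop :=
  (exists w1 w2 : R -> R,
     is_derivative_on_segm l w w1 /\
     is_derivative_on_segm l w1 w2 /\
     forall x, segm l x -> a * w x - b * w2 x = f x) /\
  w 0 = 0 /\ w l = 0.

(* Bonnet's recursion
   (k + 2) P_(k+2)(x) = (2 k + 3) x P_(k+1)(x) - (k + 1) P_k(x),
   P_0(x) = 1, P_1(x) = x, normalised by P_m(1) = 1. *)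
Fixpoint legendre (m : nat) (x : R) {struct m} : R :=
  match m with
  | O => 1
  | S m' =>
      match m' with
      | O => x
      | S k =>
          ((2 * INR k + 3) * x * legendre m' x - (INR k + 1) * legendre k x)
          / (INR k + 2)
      end
  end.

Definition shifted_legendre (l : R) (m : nat) (x : R) : R :=
  legendre m (2 * x / l - 1).

Definition A_coef (m : nat) : R := 1 / sqrt (2 * INR m + 1).

Definition normalized_legendre (l : R) (m : nat) (x : R) : R :=
  1 / (A_coef m * sqrt l) * shifted_legendre l m x.

Definition phi (l : R) (m : nat) (x : R) : R :=
  RInt (normalized_legendre l m) 0 x.

(* a_1 phi_1 + ... + a_N phi_N; only the values alpha 1, ..., alpha N matter. *)
Definition galerkin_sum (l : R) (N : nat) (alpha : nat -> R) (x : R) : R :=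
  sum_n_m (fun m => alpha m * phi l m x) 1 N.

Definition solves_ritz_galerkin
    (l a b : R) (f : R -> R) (N : nat) (alpha : nat -> R) : Prop :=
  let wN := galerkin_sum l N alpha in
  forall m : nat, (1 <= m <= N)%nat ->
    b * inner_L2 l (Derive wN) (Derive (phi l m)) + a * inner_L2 l wN (phi l m)
    = inner_L2 l f (phi l m).

(* Main.v *)
Require Import Defs.
From Stdlib Require Import Reals Lra Lia Arith.
From Coquelicot Require Import Coquelicot.
Open Scope R_scope.

(** Let [G = w'].  The derivatives of the basis functions [phi l m] are the
    orthonormal shifted Legendre polynomials of degrees [1, ..., N], and [G] has
    mean zero because [w] vanishes at both ends; so the derivative of the
    element [sum_m c_m phi_m] of the trial space, with [c_m] the Legendre
    coefficients of [G], is exactly the [L^2]-projection of [G] onto the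
    polynomials of degree at most [N].

    The proof compares the Galerkin solution with that element.  Galerkin
    orthogonality makes [w_N] optimal in the energy norm
    [b |e'|^2 + a |e|^2] ([galerkin_quasi_optimal]), and the energy norm of
    the comparison error is controlled by its derivative alone through a
    Poincare inequality ([poincare]).  Everything reduces to the error of the
    Legendre projection of a function of class [C^p] ([galerkin_error]).

    Write [E_n(g)] for the squared norm of [g] minus its projection onto degrees
    below [n].  The primitive of a normalized Legendre polynomial is a
    combination of its two neighbours in degree with weights of size [O(l/m)]
    ([is_derive_transfer]), so integration by parts expresses the [m]-th
    coefficient of [g] by two coefficients of [g'] with such weights.  Summing
    squares gives [E_(n+1)(g) <= (l/(n+1))^2 E_n(g')] ([tail_derive]), and [p]
    applications give [E_n(g) = O(n^(-2p))] ([tail_rate]).  The resulting error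
    bound is of order [N^(-p)], which is stronger than the claimed
    [N^(-(p-1/2))].

    Identifying [E_n(g)] with the sum of the squared coefficients of degree at
    least [n] requires that [E_n(g)] tend to zero ([tail_lim]).  For the
    continuously differentiable [g] at hand this follows from the quadratic
    estimate for Bernstein polynomials of a Lipschitz function.

    Since the hypotheses speak of one-sided derivatives on [[0, l]], [w] is
    first replaced by a function of the same class on the whole line that agrees
    with it on the interval ([of_class_C_extend]). *)

(** * Continuous functions and the inner product *)

Definition cont (f : R -> R) : Prop := forall x, continuous f x.

Lemma cont_plus f g : cont f -> cont g -> cont (fun x => f x + g x).
Proof. intros Hf Hg x. exact (continuous_plus f g x (Hf x) (Hg x)). Qed.
Lemma cont_minus f g : cont f -> cont g -> cont (fun x => f x - g x).
Proof. intros Hf Hg x. exact (continuous_minus f g x (Hf x) (Hg x)). Qed.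
Lemma cont_mult f g : cont f -> cont g -> cont (fun x => f x * g x).
Proof. intros Hf Hg x. exact (continuous_mult f g x (Hf x) (Hg x)). Qed.
Lemma cont_const c : cont (fun _ => c).
Proof. intros x. apply continuous_const. Qed.
Lemma cont_id : cont (fun x => x).
Proof. intros x. apply continuous_id. Qed.
Lemma cont_of_derive (f f' : R -> R) : (forall x, is_derive f x (f' x)) -> cont f.
Proof. intros H x. apply (ex_derive_continuous f). exists (f' x). apply H. Qed.

Create HintDb cont.
#[export] Hint Resolve cont_plus cont_minus cont_mult cont_const cont_id : cont.

Lemma cont_RInt f u v : cont f -> ex_RInt f u v.
Proof. intros Hf. apply (ex_RInt_continuous f). intros z _. apply Hf. Qed.

Lemma is_derive_antiderivative (G : R -> R) (c y : R) :
  cont G -> is_derive (fun y => c + RInt G 0 y) y (G y).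
Proof.
  intros CG. replace (G y) with (plus 0 (G y)) by (unfold plus; simpl; ring).
  apply (is_derive_plus (fun _ => c) (fun y => RInt G 0 y)).
  - apply (is_derive_const (K := R_AbsRing) (V := R_NormedModule)).
  - apply (is_derive_RInt G (fun y => RInt G 0 y) 0); [|apply CG].
    apply filter_forall. intros z.
    apply (RInt_correct (V := R_CompleteNormedModule)), cont_RInt, CG.
Qed.

Lemma cont_ext f g : (forall x, f x = g x) -> cont f -> cont g.
Proof. intros H Hf x. apply (continuous_ext f); auto. Qed.

Section Inner.
Variable l : R.
Hypothesis hl : 0 < l.

Lemma inner_ext u v u' v' :
  (forall x, 0 < x < l -> u x * v x = u' x * v' x) ->
  inner_L2 l u v = inner_L2 l u' v'.
Proof.
  intros H. unfold inner_L2. apply RInt_ext. intros x.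
  rewrite Rmin_left, Rmax_right by lra. apply H.
Qed.

Lemma inner_comm u v : inner_L2 l u v = inner_L2 l v u.
Proof. apply inner_ext. intros; ring. Qed.

(** Two scalars, so that one rewrite serves sums, differences and multiples. *)
Lemma inner_lin u1 u2 v s t : cont u1 -> cont u2 -> cont v ->
  inner_L2 l (fun x => s * u1 x + t * u2 x) v
  = s * inner_L2 l u1 v + t * inner_L2 l u2 v.
Proof.
  intros H1 H2 Hv. apply is_RInt_unique.
  apply (is_RInt_ext (fun x => plus (scal s (u1 x * v x)) (scal t (u2 x * v x)))).
  { intros. unfold plus, scal; simpl. unfold mult; simpl. ring. }
  apply (is_RInt_plus (V := R_NormedModule));
    apply (is_RInt_scal (V := R_NormedModule));
    apply (RInt_correct (V := R_CompleteNormedModule)), cont_RInt; auto with cont.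
Qed.

Lemma inner_lin_r u1 u2 v s t : cont u1 -> cont u2 -> cont v ->
  inner_L2 l v (fun x => s * u1 x + t * u2 x)
  = s * inner_L2 l v u1 + t * inner_L2 l v u2.
Proof.
  intros. rewrite inner_comm, inner_lin by assumption.
  now rewrite (inner_comm u1), (inner_comm u2).
Qed.

Lemma inner_le u v u' v' : cont u -> cont v -> cont u' -> cont v' ->
  (forall x, 0 < x < l -> u x * v x <= u' x * v' x) ->
  inner_L2 l u v <= inner_L2 l u' v'.
Proof.
  intros Hu Hv Hu' Hv' H. unfold inner_L2.
  apply RInt_le; try lra; try (apply cont_RInt; auto with cont). exact H.
Qed.

Lemma inner_const c d : inner_L2 l (fun _ => c) (fun _ => d) = l * (c * d).
Proof.
  unfold inner_L2. rewrite RInt_const. unfold scal; simpl. unfold mult; simpl. ring.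
Qed.

Lemma inner_pos u : cont u -> 0 <= inner_L2 l u u.
Proof.
  intros Hu. replace 0 with (inner_L2 l (fun _ => 0) (fun _ => 0)).
  - apply inner_le; auto with cont. intros. nra.
  - rewrite inner_const. ring.
Qed.

Lemma inner_by_parts (u u' v v' : R -> R) :
  (forall x, is_derive u x (u' x)) -> (forall x, is_derive v x (v' x)) ->
  cont u' -> cont v' ->
  inner_L2 l u' v + inner_L2 l u v' = u l * v l - u 0 * v 0.
Proof.
  intros Hu Hv Cu Cv.
  assert (cont u) by (eapply cont_of_derive; eauto).
  assert (cont v) by (eapply cont_of_derive; eauto).
  unfold inner_L2.
  rewrite <- (RInt_plus (V := R_CompleteNormedModule))
    by (apply cont_RInt; auto with cont).
  apply is_RInt_unique.
  apply (is_RInt_derive (V := R_CompleteNormedModule) (fun x => u x * v x)).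
  - intros x _. apply (is_derive_mult (K := R_AbsRing) u v); auto. intros; apply Rmult_comm.
  - intros x _. apply (cont_plus (fun x => u' x * v x) (fun x => u x * v' x));
      auto with cont.
Qed.
End Inner.

(** * Differential identities for Legendre polynomials *)

(** Bonnet's recursion differentiated term by term, so that identities between
    derivatives are proved by the same algebra as those between values. *)
Fixpoint legendre' (m : nat) (x : R) {struct m} : R :=
  match m with
  | O => 0
  | S m' =>
      match m' with
      | O => 1
      | S k =>
          ((2 * INR k + 3) * (legendre m' x + x * legendre' m' x)
           - (INR k + 1) * legendre' k x) / (INR k + 2)
      end
  end.

Lemma nat_ind2 (P : nat -> Prop) :
  P 0%nat -> P 1%nat -> (forall n, P n -> P (S n) -> P (S (S n))) -> forall n, P n.
Proof.
  intros H0 H1 H n. cut (P n /\ P (S n)); [tauto|]. induction n; firstorder.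
Qed.

Lemma legendre_SS k x : legendre (S (S k)) x =
  ((2 * INR k + 3) * x * legendre (S k) x - (INR k + 1) * legendre k x) / (INR k + 2).
Proof. reflexivity. Qed.

Lemma legendre'_SS k x : legendre' (S (S k)) x =
  ((2 * INR k + 3) * (legendre (S k) x + x * legendre' (S k) x)
           - (INR k + 1) * legendre' k x) / (INR k + 2).
Proof. reflexivity. Qed.

Lemma is_derive_bonnet (u v : R -> R) (u' v' A B C x : R) : C <> 0 ->
  is_derive u x u' -> is_derive v x v' ->
  is_derive (fun x => (A * x * u x - B * v x) / C) x
    ((A * (u x + x * u') - B * v') / C).
Proof.
  intros HC Hu Hv.
  assert (Eu : ex_derive u x) by (eexists; apply Hu).
  assert (Ev : ex_derive v x) by (eexists; apply Hv).
  apply is_derive_unique in Hu, Hv.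
  auto_derive; [tauto|].
  change (fun x => u x) with u. change (fun x => v x) with v.
  rewrite Hu, Hv. field. exact HC.
Qed.

Lemma is_derive_legendre m x : is_derive (legendre m) x (legendre' m x).
Proof.
  induction m as [| |k IH0 IH1] using nat_ind2.
  - apply (is_derive_const (K := R_AbsRing) (V := R_NormedModule) 1 x).
  - apply (is_derive_id (K := R_AbsRing) x).
  - pose proof (pos_INR k).
    apply (is_derive_bonnet (legendre (S k)) (legendre k)); auto. lra.
Qed.

(** Writing the lower index as [pred n] makes the recursion hold for [n = 0] too,
    where its last term has the factor [0]. *)
Lemma legendre_bonnet n x :
  (INR n + 1) * legendre (S n) x
  = (2 * INR n + 1) * (x * legendre n x) - INR n * legendre (pred n) x.
Proof.
  destruct n as [|n].
  - simpl. ring.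
  - rewrite legendre_SS, S_INR. simpl pred. pose proof (pos_INR n). field. lra.
Qed.

(** The two classical relations between consecutive derivatives.  They are proved
    together: the second one for [n] turns the differentiated Bonnet recursion
    into the first one for [n + 1], and two instances of the first one give the
    next instance of the second. *)
Lemma legendre'_rec n x :
  legendre' (S n) x = x * legendre' n x + (INR n + 1) * legendre n x /\
  x * legendre' (S n) x - legendre' n x = (INR n + 1) * legendre (S n) x.
Proof.
  induction n as [|n [I II]].
  - simpl. split; ring.
  - pose proof (pos_INR n).
    assert (I' : legendre' (S (S n)) x
                 = x * legendre' (S n) x + (INR (S n) + 1) * legendre (S n) x).
    { rewrite legendre'_SS, S_INR.
      apply (Rmult_eq_reg_l (INR n + 2)); [|lra]. field_simplify; [|lra].
      replace (legendre' n x) with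
        (x * legendre' (S n) x - (INR n + 1) * legendre (S n) x) by lra. ring. }
    split; [exact I'|].
    rewrite I', legendre_SS, S_INR.
    assert (J : x * (x * legendre' (S n) x) =
       x * legendre' n x + x * ((INR n + 1) * legendre (S n) x)) by (rewrite <- II; ring).
    replace (x * (x * legendre' (S n) x + (INR n + 1 + 1) * legendre (S n) x))
      with (x * (x * legendre' (S n) x) + (INR n + 2) * x * legendre (S n) x) by ring.
    rewrite J, I. field. lra.
Qed.

(** This identity is what makes primitives of Legendre polynomials explicit. *)
Lemma legendre'_diff n x :
  legendre' (S (S n)) x - legendre' n x = (2 * INR n + 3) * legendre (S n) x.
Proof.
  destruct (legendre'_rec n x) as [_ II], (legendre'_rec (S n) x) as [I _].
  rewrite I, S_INR. replace (legendre' n x) with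
   (x * legendre' (S n) x - (INR n + 1) * legendre (S n) x) by lra. ring.
Qed.

Lemma legendre_flux n x :
  (x * x - 1) * legendre' n x = INR n * (x * legendre n x - legendre (pred n) x).
Proof.
  destruct n as [|n]; [simpl; ring|].
  destruct (legendre'_rec n x) as [I II]. simpl pred. rewrite S_INR.
  replace ((x * x - 1) * legendre' (S n) x) with
     (x * (x * legendre' (S n) x) - legendre' (S n) x) by ring.
  replace (x * legendre' (S n) x) with
    (legendre' n x + (INR n + 1) * legendre (S n) x) by lra.
  rewrite I. ring.
Qed.

(** The Sturm-Liouville form of Legendre's equation.  By [legendre_flux] the flux
    [(x^2 - 1) P_n'] is a polynomial without derivatives, so second derivatives
    never appear. *)
Lemma is_derive_legendre_flux n x :
  is_derive (fun x => (x * x - 1) * legendre' n x) x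
    (INR n * (INR n + 1) * legendre n x).
Proof.
  pose proof (is_derive_bonnet _ _ _ _ (INR n) (INR n) 1 x R1_neq_R0
    (is_derive_legendre n x) (is_derive_legendre (pred n) x)) as H.
  replace (INR n * (INR n + 1) * legendre n x) with
    ((INR n * (legendre n x + x * legendre' n x) - INR n * legendre' (pred n) x) / 1).
  - eapply is_derive_ext; [|exact H].
    intros t. cbv beta. rewrite legendre_flux.
    change (@eq R ((INR n * t * legendre n t - INR n * legendre (pred n) t) / 1)
      (INR n * (t * legendre n t - legendre (pred n) t))). field.
  - destruct n as [|n]; [simpl; field|].
    destruct (legendre'_rec n x) as [_ II]. simpl pred.
    replace (legendre' n x) with
      (x * legendre' (S n) x - (INR n + 1) * legendre (S n) x) by lra.
    rewrite S_INR. field.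
Qed.

Lemma legendre_m1 n : legendre (S (S n)) (-1) = legendre n (-1).
Proof.
  cut (legendre (S n) (-1) = - legendre n (-1)).
  { intros H. rewrite legendre_SS, H. pose proof (pos_INR n). field. lra. }
  induction n as [|n IH]; [simpl; lra|].
  rewrite legendre_SS, IH. pose proof (pos_INR n). field. lra.
Qed.

(** * Orthonormality on the interval and the primitives [phi] *)

Section Shifted.
Variable l : R.
Hypothesis hl : 0 < l.

Lemma is_derive_shift (F F' : R -> R) (x : R) :
  (forall y, is_derive F y (F' y)) ->
  is_derive (fun x => F (2 * x / l - 1)) x (2 / l * F' (2 * x / l - 1)).
Proof.
  intros H.
  apply (is_derive_comp F (fun x => 2 * x / l - 1)); [apply H|].
  auto_derive; [trivial|]. field. lra.
Qed.

Lemma cont_shift F : cont F -> cont (fun x => F (2 * x / l - 1)).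
Proof.
  intros H x. apply (continuous_comp (fun x => 2 * x / l - 1) F); [|apply H].
  apply (ex_derive_continuous (fun x => 2 * x / l - 1)). auto_derive. trivial.
Qed.

Lemma cont_legendre m : cont (legendre m).
Proof. eapply cont_of_derive, is_derive_legendre. Qed.

Lemma cont_legendre' m : cont (legendre' m).
Proof.
  induction m as [| |k IH0 IH1] using nat_ind2.
  - apply cont_const.
  - apply cont_const.
  - pose proof (cont_legendre (S k)).
    apply (cont_mult (fun x => (2 * INR k + 3) * (legendre (S k) x + x * legendre' (S k) x)
           - (INR k + 1) * legendre' k x) (fun _ => / (INR k + 2))); auto 10 with cont.
Qed.

Lemma cont_shifted m : cont (shifted_legendre l m).
Proof. apply cont_shift, cont_legendre. Qed.

Lemma is_derive_shifted m x :
  is_derive (shifted_legendre l m) x (2 / l * legendre' m (2 * x / l - 1)).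
Proof. apply is_derive_shift. intros; apply is_derive_legendre. Qed.

(** Legendre's equation tested against another Legendre polynomial: the flux
    vanishes at both ends, and the right-hand side is symmetric in [m] and [n],
    whence orthogonality. *)
Lemma shifted_energy m n :
  INR m * (INR m + 1) * inner_L2 l (shifted_legendre l m) (shifted_legendre l n)
  = - inner_L2 l
      (fun x => (2 * x / l - 1) * (2 * x / l - 1) - 1)
      (fun x => legendre' m (2 * x / l - 1) * legendre' n (2 * x / l - 1)).
Proof.
  pose proof (cont_legendre' m). pose proof (cont_legendre' n).
  pose proof (cont_shifted m). pose proof (cont_shifted n).
  pose proof (cont_shift (legendre' m)). pose proof (cont_shift (legendre' n)).
  assert (cont (fun x => 2 * x / l - 1)) by apply (cont_shift _ cont_id).
  pose proof (inner_by_parts l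
    (fun x => ((2 * x / l - 1) * (2 * x / l - 1) - 1) * legendre' m (2 * x / l - 1))
    (fun x => 2 / l * (INR m * (INR m + 1) * shifted_legendre l m x))
    (shifted_legendre l n)
    (fun x => 2 / l * legendre' n (2 * x / l - 1))
    (fun x => is_derive_shift (fun y => (y * y - 1) * legendre' m y) _ x
      (is_derive_legendre_flux m))
    (is_derive_shifted n) ltac:(auto with cont) ltac:(auto with cont)) as HI.
  cbv beta in HI.
  replace (2 * l / l - 1) with 1 in HI by (field; lra).
  replace (2 * 0 / l - 1) with (-1) in HI by (field; lra).
  rewrite (inner_ext l hl _ _
    (fun x => (2 / l * (INR m * (INR m + 1))) * shifted_legendre l m x + 0 * 0)
    (shifted_legendre l n)) in HI by (intros; ring).
  rewrite (inner_lin l) in HI by auto with cont.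
  rewrite (inner_ext l hl
    (fun x => ((2 * x / l - 1) * (2 * x / l - 1) - 1) * legendre' m (2 * x / l - 1))
    _ (fun x => 2 / l * ((2 * x / l - 1) * (2 * x / l - 1) - 1) + 0 * 0)
    (fun x => legendre' m (2 * x / l - 1) * legendre' n (2 * x / l - 1))) in HI
   by (intros; ring).
  rewrite (inner_lin l) in HI by auto with cont.
  apply (Rmult_eq_reg_l (2 / l)).
  2:{ apply Rgt_not_eq, Rdiv_lt_0_compat; lra. }
  lra.
Qed.

Lemma shifted_orthogonal m n : m <> n ->
  inner_L2 l (shifted_legendre l m) (shifted_legendre l n) = 0.
Proof.
  intros Hmn.
  pose proof (shifted_energy m n) as H1. pose proof (shifted_energy n m) as H2.
  rewrite (inner_comm l hl (shifted_legendre l n)) in H2.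
  rewrite (inner_ext l hl _ (fun x => legendre' n (2 * x / l - 1) * legendre' m (2 * x / l - 1))
     (fun x => (2 * x / l - 1) * (2 * x / l - 1) - 1)
     (fun x => legendre' m (2 * x / l - 1) * legendre' n (2 * x / l - 1))) in H2
   by (intros; ring).
  rewrite <- H1 in H2. clear H1.
  pose proof (pos_INR m). pose proof (pos_INR n).
  assert (INR m <> INR n) by (intros E; apply Hmn, INR_eq, E).
  set (I := inner_L2 _ _ _) in *.
  assert (E : (INR n - INR m) * ((INR n + INR m + 1) * I) = 0) by lra.
  apply Rmult_integral in E. destruct E as [E|E]; [lra|].
  apply Rmult_integral in E. destruct E as [E|E]; lra.
Qed.

(** Multiplication by the affine variable [2 x / l - 1] raises the degree by at
    most one; this form serves both the norms and the completeness proof. *)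
Lemma inner_bonnet r n : cont r ->
  (2 * INR n + 1) * inner_L2 l r (fun x => (2 * x / l - 1) * shifted_legendre l n x)
  = (INR n + 1) * inner_L2 l r (shifted_legendre l (S n))
    + INR n * inner_L2 l r (shifted_legendre l (pred n)).
Proof.
  intros Hr. pose proof (cont_shifted n).
  assert (cont (fun x => 2 * x / l - 1)) by apply (cont_shift _ cont_id).
  rewrite <- inner_lin_r by auto using cont_shifted.
  rewrite (inner_ext l hl r (fun x => (INR n + 1) * _ x + _) r
    (fun x => (2 * INR n + 1) * ((2 * x / l - 1) * shifted_legendre l n x) + 0 * 0)).
  - rewrite inner_lin_r by auto with cont. ring.
  - intros x _. f_equal. unfold shifted_legendre.
    rewrite (legendre_bonnet n (2 * x / l - 1)). ring.
Qed.

(** The product of two neighbours with the affine variable can be expanded by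
    Bonnet's recursion in either factor, which relates consecutive norms. *)
Lemma shifted_norm n :
  (2 * INR n + 1) * inner_L2 l (shifted_legendre l n) (shifted_legendre l n) = l.
Proof.
  induction n as [|n IH].
  - unfold shifted_legendre; simpl. rewrite inner_const. ring.
  - pose proof (inner_bonnet _ n (cont_shifted (S n))) as H1.
    pose proof (inner_bonnet _ (S n) (cont_shifted n)) as H2.
    rewrite (shifted_orthogonal n (S (S n))) in H2 by lia.
    rewrite (inner_ext l hl _ _ (shifted_legendre l (S n))
      (fun x => (2 * x / l - 1) * shifted_legendre l n x)) in H2 by (intros; ring).
    assert (H3 : INR n * inner_L2 l (shifted_legendre l (S n)) (shifted_legendre l (pred n)) = 0).
    { destruct n; [simpl; ring|]. rewrite shifted_orthogonal by (simpl; lia). ring. }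
    simpl pred in H2. rewrite S_INR in H2 |- *. pose proof (pos_INR n).
    set (I := inner_L2 l (shifted_legendre l (S n)) (fun _ => _)) in *.
    set (X := inner_L2 l (shifted_legendre l (S n)) (shifted_legendre l (S n))) in *.
    set (Z := inner_L2 l (shifted_legendre l n) (shifted_legendre l n)) in *.
    assert (E1 : (INR n + 1) * X = (2 * INR n + 1) * I) by lra.
    assert (E2 : (INR n + 1) * Z = (2 * (INR n + 1) + 1) * I) by lra.
    apply (Rmult_eq_reg_l (INR n + 1)); [|lra]. rewrite <- IH.
    transitivity ((2 * (INR n + 1) + 1) * ((INR n + 1) * X)); [ring|].
    transitivity ((2 * INR n + 1) * ((INR n + 1) * Z)); [|ring].
    rewrite E1, E2. ring.
Qed.

Lemma normalized_eq m x : normalized_legendre l m x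
  = sqrt (2 * INR m + 1) / sqrt l * shifted_legendre l m x.
Proof.
  unfold normalized_legendre, A_coef. pose proof (pos_INR m).
  assert (0 < sqrt (2 * INR m + 1)) by (apply sqrt_lt_R0; lra).
  assert (0 < sqrt l) by (apply sqrt_lt_R0; lra).
  field. lra.
Qed.

Lemma cont_normalized m : cont (normalized_legendre l m).
Proof.
  pose proof (cont_shifted m). unfold normalized_legendre. auto with cont.
Qed.

Lemma inner_normalized r m : cont r ->
  inner_L2 l r (normalized_legendre l m)
  = sqrt (2 * INR m + 1) / sqrt l * inner_L2 l r (shifted_legendre l m).
Proof.
  intros Hr. pose proof (cont_shifted m).
  rewrite (inner_ext l hl r _ r
    (fun x => sqrt (2 * INR m + 1) / sqrt l * shifted_legendre l m x + 0 * 0)).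
  - rewrite inner_lin_r by auto with cont. ring.
  - intros. rewrite normalized_eq. ring.
Qed.

Lemma normalized_orthonormal m n :
  inner_L2 l (normalized_legendre l m) (normalized_legendre l n)
  = if Nat.eq_dec m n then 1 else 0.
Proof.
  rewrite inner_normalized by apply cont_normalized.
  rewrite (inner_comm l hl), inner_normalized by apply cont_shifted.
  destruct (Nat.eq_dec m n) as [<-|Hmn].
  - pose proof (shifted_norm m) as HN. pose proof (pos_INR m).
    set (I := inner_L2 _ _ _) in *.
    transitivity ((sqrt (2 * INR m + 1) * sqrt (2 * INR m + 1)) * I
                   / (sqrt l * sqrt l)).
    { assert (0 < sqrt l) by (apply sqrt_lt_R0; lra). field. lra. }
    rewrite !sqrt_sqrt, HN by lra. field. lra.
  - rewrite shifted_orthogonal by auto. ring.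
Qed.

(** Integration from [0] is tridiagonal in the orthonormal Legendre basis on the
    degrees [m >= 1], with zero diagonal and entries of opposite signs across it;
    these are their absolute values. *)
Definition transfer (k : nat) : R :=
  l / 2 / (sqrt (2 * INR k + 1) * sqrt (2 * INR k + 3)).

Lemma is_derive_transfer k x :
  is_derive (fun x => transfer (S k) * normalized_legendre l (S (S k)) x
                      - transfer k * normalized_legendre l k x) x
    (normalized_legendre l (S k) x).
Proof.
  pose proof (pos_INR k).
  assert (0 < sqrt l) by (apply sqrt_lt_R0; lra).
  assert (0 < sqrt (2 * INR k + 1)) by (apply sqrt_lt_R0; lra).
  assert (0 < sqrt (2 * INR k + 3)) by (apply sqrt_lt_R0; lra).
  assert (0 < sqrt (2 * INR k + 5)) by (apply sqrt_lt_R0; lra).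
  pose proof (is_derive_shift
    (fun y => l / 2 / (sqrt (2 * INR k + 3) * sqrt l) *
       (legendre (S (S k)) y - legendre k y))
    (fun y => l / 2 / (sqrt (2 * INR k + 3) * sqrt l) *
       (legendre' (S (S k)) y - legendre' k y)) x) as HD.
  eapply is_derive_ext; [|match type of HD with _ -> ?C =>
     assert (HC : C); [apply HD|] end].
  3:{ replace (normalized_legendre l (S k) x) with
       (2 / l * (l / 2 / (sqrt (2 * INR k + 3) * sqrt l) *
          (legendre' (S (S k)) (2 * x / l - 1) - legendre' k (2 * x / l - 1)))).
      - exact HC.
      - rewrite legendre'_diff, normalized_eq, S_INR.
        unfold shifted_legendre.
        replace (2 * (INR k + 1) + 1) with (2 * INR k + 3) by ring.
        rewrite <- (sqrt_sqrt (2 * INR k + 3)) at 2 by lra.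
        field. lra. }
  - intros t. cbv beta. rewrite !normalized_eq. unfold transfer.
    rewrite !S_INR.
    replace (2 * (INR k + 1) + 1) with (2 * INR k + 3) by ring.
    replace (2 * (INR k + 1) + 3) with (2 * INR k + 5) by ring.
    replace (2 * (INR k + 1 + 1) + 1) with (2 * INR k + 5) by ring.
    unfold shifted_legendre.
    match goal with |- ?a = ?b => change (@eq R a b) end.
    field. lra.
  - intros y.
    apply (is_derive_scal (fun y => legendre (S (S k)) y - legendre k y)).
    apply (is_derive_minus (legendre (S (S k))) (legendre k)); apply is_derive_legendre.
Qed.

(** Both sides vanish at [0], because [P_(k+2)] and [P_k] have equal parity. *)
Lemma phi_eq k x :
  phi l (S k) x = transfer (S k) * normalized_legendre l (S (S k)) x
                      - transfer k * normalized_legendre l k x.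
Proof.
  unfold phi. apply is_RInt_unique.
  set (F := fun x => transfer (S k) * normalized_legendre l (S (S k)) x
                      - transfer k * normalized_legendre l k x).
  change (is_RInt (normalized_legendre l (S k)) 0 x (F x)).
  replace (F x) with (minus (F x) (F 0)).
  - apply (is_RInt_derive (V := R_CompleteNormedModule)).
    + intros t _. apply is_derive_transfer.
    + intros t _. apply cont_normalized.
  - assert (F 0 = 0) as ->; [|unfold minus, plus, opp; simpl; ring].
    unfold F, transfer. rewrite !normalized_eq. unfold shifted_legendre.
    replace (2 * 0 / l - 1) with (-1) by (field; lra).
    rewrite legendre_m1, !S_INR. pose proof (pos_INR k).
    replace (2 * (INR k + 1) + 1) with (2 * INR k + 3) by ring.
    replace (2 * (INR k + 1) + 3) with (2 * INR k + 5) by ring.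
    replace (2 * (INR k + 1 + 1) + 1) with (2 * INR k + 5) by ring.
    assert (0 < sqrt l) by (apply sqrt_lt_R0; lra).
    assert (0 < sqrt (2 * INR k + 1)) by (apply sqrt_lt_R0; lra).
    assert (0 < sqrt (2 * INR k + 3)) by (apply sqrt_lt_R0; lra).
    assert (0 < sqrt (2 * INR k + 5)) by (apply sqrt_lt_R0; lra).
    field. lra.
Qed.

Lemma is_derive_phi m x : is_derive (phi l m) x (normalized_legendre l m x).
Proof.
  apply (is_derive_ext (fun y => 0 + RInt (normalized_legendre l m) 0 y)).
  - intros t. apply Rplus_0_l.
  - apply is_derive_antiderivative, cont_normalized.
Qed.

Lemma cont_phi m : cont (phi l m).
Proof. eapply cont_of_derive, is_derive_phi. Qed.

Lemma phi_0 m : phi l m 0 = 0.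
Proof. unfold phi. apply (RInt_point (V := R_CompleteNormedModule)). Qed.

(** The value at [l] is the inner product with the constant polynomial. *)
Lemma phi_l m : (1 <= m)%nat -> phi l m l = 0.
Proof.
  intros Hm. transitivity (inner_L2 l (normalized_legendre l m) (shifted_legendre l 0)).
  - unfold phi, inner_L2. apply RInt_ext. intros.
    unfold shifted_legendre; simpl. ring.
  - rewrite inner_comm, inner_normalized, shifted_orthogonal
      by (try apply cont_shifted; lia || lra). ring.
Qed.
End Shifted.

(** * Remainders of Legendre expansions *)

Section Remainder.
Variable l : R.
Hypothesis hl : 0 < l.

Definition legendre_coef (g : R -> R) (m : nat) : R :=
  inner_L2 l g (normalized_legendre l m).

(** Indexed by the number of modes removed, not by the highest degree removed, so
    that [remainder g 0] is [g] and the decay estimate goes from [n] to [n + 1]. *)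
Fixpoint remainder (g : R -> R) (n : nat) (x : R) : R :=
  match n with
  | O => g x
  | S m => remainder g m x - legendre_coef g m * normalized_legendre l m x
  end.

Definition tail (g : R -> R) (n : nat) : R :=
  inner_L2 l (remainder g n) (remainder g n).

Variable g : R -> R.
Hypothesis Cg : cont g.

Lemma cont_remainder n : cont (remainder g n).
Proof.
  induction n as [|n IH]; [exact Cg|].
  pose proof (cont_normalized l n). simpl. auto with cont.
Qed.

Lemma remainder_coef n m :
  legendre_coef (remainder g n) m = if le_lt_dec n m then legendre_coef g m else 0.
Proof.
  induction n as [|n IH]; [reflexivity|].
  pose proof (cont_normalized l n). pose proof (cont_normalized l m).
  pose proof (cont_remainder n).
  transitivity (1 * legendre_coef (remainder g n) m
    + - legendre_coef g n * legendre_coef (normalized_legendre l n) m).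
  { unfold legendre_coef at 1 2 4. rewrite <- inner_lin by assumption.
    apply inner_ext; [exact hl|]. intros. simpl. ring. }
  rewrite IH. unfold legendre_coef at 3. rewrite normalized_orthonormal by exact hl.
  destruct (le_lt_dec n m), (le_lt_dec (S n) m), (Nat.eq_dec n m); subst; try lia; ring.
Qed.

Lemma tail_S n : tail g (S n) = tail g n - legendre_coef g n * legendre_coef g n.
Proof.
  pose proof (cont_normalized l n) as Ce. pose proof (cont_remainder n) as Cr.
  pose proof (remainder_coef n n) as Hc.
  destruct (le_lt_dec n n) as [_|]; [|lia].
  pose proof (normalized_orthonormal l hl n n) as Hn.
  destruct (Nat.eq_dec n n) as [_|]; [|lia].
  unfold legendre_coef at 1 in Hc.
  set (c := legendre_coef g n) in *. unfold tail.
  set (r := remainder g n) in *. set (e := normalized_legendre l n) in *.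
  assert (Crs : cont (fun x => 1 * r x + - c * e x)) by auto with cont.
  rewrite (inner_ext l hl (remainder g (S n)) (remainder g (S n))
    (fun x => 1 * r x + - c * e x) (fun x => 1 * r x + - c * e x))
    by (intros; simpl; fold r e c; ring).
  rewrite inner_lin, !inner_lin_r, (inner_comm l hl e r), Hc, Hn by assumption.
  ring.
Qed.

Lemma tail_pos n : 0 <= tail g n.
Proof. apply inner_pos; [exact hl|apply cont_remainder]. Qed.

Lemma tail_decr n m : (n <= m)%nat -> tail g m <= tail g n.
Proof.
  induction 1 as [|m _ IH]; [lra|]. rewrite tail_S. pose proof (Rle_0_sqr (legendre_coef g m)) as H.
  unfold Rsqr in H. lra.
Qed.

End Remainder.

(** * Completeness through Bernstein polynomials *)

(** The expectation of [F (S_n)] for a binomial variable [S_n] of parameters [n]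
    and [t], computed by conditioning on one trial.  The recursion replaces the
    explicit sum with binomial coefficients, so that every property follows by a
    direct induction. *)
Fixpoint bernstein (n : nat) (F : nat -> R) (t : R) : R :=
  match n with
  | O => F O
  | S n' => t * bernstein n' (fun k => F (S k)) t + (1 - t) * bernstein n' F t
  end.

Lemma cont_bernstein n F : cont (bernstein n F).
Proof.
  revert F. induction n as [|n IH]; intros F; [apply cont_const|].
  pose proof (IH F). pose proof (IH (fun k => F (S k))). simpl. auto with cont.
Qed.

(** The right-hand side is [A + B * E (S_n - s)^2], the second moment of the
    binomial distribution about [s] being [(n t - s)^2 + n t (1 - t)].  Leaving
    [s] free lets the induction absorb the shift of [F]. *)
Lemma bernstein_dist n F t s c A B : 0 <= t <= 1 ->
  (forall k, (k <= n)%nat -> Rabs (F k - c) <= A + B * (INR k - s) ^ 2) ->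
  Rabs (bernstein n F t - c)
  <= A + B * ((INR n * t - s) ^ 2 + INR n * (t * (1 - t))).
Proof.
  intros Ht. revert F s. induction n as [|n IH]; intros F s HF.
  - simpl bernstein. eapply Rle_trans; [apply HF; lia|]. simpl. right; ring.
  - pose proof (IH F s ltac:(intros; apply HF; lia)) as H0.
    pose proof (IH (fun k => F (S k)) (s - 1)) as H1.
    assert (Hs : forall k, (k <= n)%nat ->
      Rabs (F (S k) - c) <= A + B * (INR k - (s - 1)) ^ 2).
    { intros k Hk. eapply Rle_trans; [apply HF; lia|]. rewrite S_INR. right; ring. }
    specialize (H1 Hs). simpl bernstein.
    set (b1 := bernstein n (fun k => F (S k)) t) in *.
    set (b0 := bernstein n F t) in *.
    replace (t * b1 + (1 - t) * b0 - c) with (t * (b1 - c) + (1 - t) * (b0 - c)) by ring.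
    eapply Rle_trans; [apply Rabs_triang|].
    rewrite !Rabs_mult, (Rabs_pos_eq t), (Rabs_pos_eq (1 - t)) by lra.
    eapply Rle_trans.
    { apply Rplus_le_compat; (apply Rmult_le_compat_l; [lra|]); [apply H1|apply H0]. }
    rewrite S_INR. right. ring.
Qed.

Section Completeness.
Variable l : R.
Hypothesis hl : 0 < l.

Lemma cont_bernstein_scaled n F : cont (fun x => bernstein n F (x / l)).
Proof.
  intros x. apply (continuous_comp (fun x => x / l) (bernstein n F)).
  - apply (cont_mult (fun x => x) (fun _ => / l)); auto with cont.
  - apply cont_bernstein.
Qed.

(** A Bernstein polynomial of order [n] has degree at most [n].  Instead of
    expanding it in the Legendre basis, the induction moves the factor [x / l]
    of the recursion onto [r]: by Bonnet's recursion this costs orthogonality to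
    one degree only. *)
Lemma orthogonal_bernstein n : forall r F, cont r ->
  (forall m, (m <= n)%nat -> inner_L2 l r (shifted_legendre l m) = 0) ->
  inner_L2 l r (fun x => bernstein n F (x / l)) = 0.
Proof.
  induction n as [|n IH]; intros r F Cr Hr.
  - rewrite (inner_ext l hl r _ r (fun x => F O * shifted_legendre l 0 x + 0 * 0))
      by (intros; unfold shifted_legendre; simpl; ring).
    pose proof (cont_shifted l 0).
    rewrite inner_lin_r, Hr by (auto with cont || lia). ring.
  - assert (Cx : cont (fun x => x / l))
      by (apply (cont_mult (fun x => x) (fun _ => / l)); auto with cont).
    assert (Crx : cont (fun x => r x * (x / l))) by auto with cont.
    assert (Hrx : forall m, (m <= n)%nat ->
       inner_L2 l (fun x => r x * (x / l)) (shifted_legendre l m) = 0).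
    { intros m Hm. pose proof (cont_shifted l m).
      assert (cont (fun x => 2 * x / l - 1)) by apply (cont_shift _ _ cont_id).
      rewrite (inner_ext l hl _ _ r (fun x =>
        / 2 * ((2 * x / l - 1) * shifted_legendre l m x) + / 2 * shifted_legendre l m x))
        by (intros; field; lra).
      rewrite inner_lin_r, (Hr m) by (auto with cont || lia).
      pose proof (inner_bonnet l hl r m Cr) as HB.
      rewrite !Hr in HB by (destruct m; simpl; lia).
      pose proof (pos_INR m).
      set (I := inner_L2 _ _ _) in *.
      assert (HI : (2 * INR m + 1) * I = 0) by lra.
      apply Rmult_integral in HI. destruct HI; [lra|]. lra. }
    pose proof (cont_bernstein_scaled n F) as C0.
    pose proof (cont_bernstein_scaled n (fun k => F (S k))) as C1.
    rewrite (inner_ext l hl _ _ (fun x => 1 * (r x * (x / l) *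
       bernstein n (fun k => F (S k)) (x / l)) +
       1 * ((1 - x / l) * r x * bernstein n F (x / l))) (fun _ => 1))
      by (intros; simpl; ring).
    rewrite inner_lin by auto with cont.
    rewrite (inner_ext l hl _ (fun _ => 1) (fun x => r x * (x / l))
       (fun x => bernstein n (fun k => F (S k)) (x / l))) by (intros; ring).
    rewrite (inner_ext l hl _ (fun _ => 1) (fun x => 1 * r x + - (1) * (r x * (x / l)))
       (fun x => bernstein n F (x / l))) by (intros; ring).
    rewrite inner_lin by auto with cont.
    rewrite !IH by auto. ring.
Qed.

Variables g g' : R -> R.
Hypothesis Dg : forall x, is_derive g x (g' x).
Hypothesis Cg' : cont g'.

Lemma lipschitz_on_segm : exists L, 0 <= L /\
  forall x y, 0 <= x <= l -> 0 <= y <= l -> Rabs (g x - g y) <= L * Rabs (x - y).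
Proof.
  destruct (continuity_ab_maj (fun x => Rabs (g' x)) 0 l) as [M [HM _]]; [lra| |].
  { intros c _. apply continuity_pt_filterlim.
    apply (continuous_comp g' Rabs); [apply Cg'|apply continuous_Rabs]. }
  exists (Rabs (g' M)). split; [apply Rabs_pos|].
  intros x y Hx Hy.
  destruct (MVT_gen g y x g') as [c [Hc E]].
  - intros; apply Dg.
  - intros z _. apply continuity_pt_filterlim, (cont_of_derive g g' Dg).
  - rewrite E, Rabs_mult. apply Rmult_le_compat_r; [apply Rabs_pos|].
    apply HM. revert Hc. unfold Rmin, Rmax. destruct (Rle_dec y x); lra.
Qed.

Let Cg : cont g := cont_of_derive g g' Dg.

(** The norm of the remainder is the distance of [g] to the polynomials of degree at most [n]
    because it is orthogonal to all of them. *)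
Lemma tail_le_any_bernstein n F :
  tail l g (S n) <= inner_L2 l (fun x => g x - bernstein n F (x / l))
                              (fun x => g x - bernstein n F (x / l)).
Proof.
  pose proof (cont_remainder l g Cg) as Cr.
  pose proof (cont_bernstein_scaled n F) as CB.
  set (r := remainder l g (S n)).
  assert (Horth : forall m, (m <= n)%nat -> legendre_coef l r m = 0).
  { intros m Hm. unfold r. rewrite remainder_coef by assumption.
    destruct (le_lt_dec (S n) m); [lia|reflexivity]. }
  assert (HB : inner_L2 l r (fun x => bernstein n F (x / l)) = 0).
  { apply orthogonal_bernstein; [apply Cr|]. intros m Hm.
    specialize (Horth m Hm). unfold legendre_coef in Horth.
    rewrite inner_normalized in Horth by (try apply Cr; exact hl).
    pose proof (pos_INR m).
    apply Rmult_integral in Horth. destruct Horth as [H0|]; [|assumption].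
    exfalso. revert H0. apply Rgt_not_eq, Rdiv_lt_0_compat; apply sqrt_lt_R0; lra. }
  assert (Hg : forall m, (m <= S n)%nat -> inner_L2 l r (remainder l g m) = inner_L2 l r g).
  { induction m as [|m IH]; [reflexivity|]. intros Hm.
    rewrite <- IH by lia.
    pose proof (cont_normalized l m).
    transitivity (1 * inner_L2 l r (remainder l g m) + - legendre_coef l g m * legendre_coef l r m).
    - unfold legendre_coef at 2. rewrite <- inner_lin_r by (try apply Cr; assumption).
      apply inner_ext; [exact hl|]. intros. simpl. ring.
    - rewrite Horth by lia. ring. }
  pose (h := fun x => g x - bernstein n F (x / l)).
  assert (Ch : cont h) by (unfold h; auto with cont).
  assert (Hrh : inner_L2 l r h = tail l g (S n)).
  { transitivity (1 * inner_L2 l r g + - (1) * inner_L2 l r (fun x => bernstein n F (x / l))).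
    - rewrite <- inner_lin_r by (try apply Cr; assumption).
      apply inner_ext; [exact hl|]. intros. unfold h. ring.
    - rewrite HB, <- (Hg (S n)) by lia. fold r. unfold tail. fold r. ring. }
  pose proof (inner_pos l hl (fun x => 1 * r x + - (1) * h x)) as HP.
  assert (cont (fun x => 1 * r x + - (1) * h x))
    by (pose proof (Cr (S n)); fold r in H; auto with cont).
  rewrite inner_lin, !inner_lin_r, (inner_comm l hl h r), Hrh in HP
    by (try apply Cr; assumption).
  change (inner_L2 l r r) with (tail l g (S n)) in HP. fold h. 
  specialize (HP H). lra.
Qed.

(** Bernstein polynomials of a function with Lipschitz constant [L] converge at
    rate [L l / sqrt n]. *)
Lemma tail_lim eps : 0 < eps -> exists M, forall m, (M <= m)%nat -> tail l g m <= eps.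
Proof.
  intros He. destruct lipschitz_on_segm as [L [HL Lip]].
  set (C := l * (L * l) ^ 2).
  assert (HC : 0 <= C) by (apply Rmult_le_pos; [lra|apply pow2_ge_0]).
  destruct (nfloor_ex (C / eps)) as [j [_ Hj]]; [apply Rdiv_le_0_compat; lra|].
  set (k := S j). assert (Hk : C / eps < INR k) by (unfold k; rewrite S_INR; lra).
  assert (Hk1 : 1 <= INR k) by (unfold k; rewrite S_INR; pose proof (pos_INR j); lra).
  (* A perfect square, whose root is the scale of the fluctuations of S_n. *)
  set (n := (k * k)%nat).
  assert (Hn : INR n = INR k * INR k) by apply mult_INR.
  exists (S n). intros m Hm.
  eapply Rle_trans; [apply (tail_decr l hl g Cg (S n) m Hm)|].
  eapply Rle_trans; [apply (tail_le_any_bernstein n (fun i => g (l * INR i / INR n)))|].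
  set (h := fun x => g x - _).
  assert (Hh : forall x, 0 < x < l -> Rabs (h x) <= L * l / INR k).
  { intros x Hx. unfold h. rewrite Rabs_minus_sym.
    assert (Ht : 0 <= x / l <= 1).
    { split; [apply Rdiv_le_0_compat; lra|].
      apply (Rmult_le_reg_r l); [lra|]. field_simplify; lra. }
    eapply Rle_trans.
    - apply (bernstein_dist n _ (x / l) (INR n * (x / l)) (g x)
         (L * l / INR n * (INR k / 2)) (L * l / INR n / (2 * INR k)) Ht).
      intros i Hi. apply le_INR in Hi. pose proof (pos_INR i).
      eapply Rle_trans.
      { apply Lip; [|lra]. split; [apply Rdiv_le_0_compat; nra|].
        apply (Rmult_le_reg_r (INR n)); [nra|]. field_simplify; nra. }
      (* |u| <= k / 2 + u^2 / (2 k) trades the absolute value for a variance. *)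
      set (u := INR i - INR n * (x / l)).
      replace (l * INR i / INR n - x) with (l / INR n * u) by (unfold u; field; nra).
      rewrite Rabs_mult, (Rabs_pos_eq (l / INR n)) by (apply Rdiv_le_0_compat; nra).
      replace (L * (l / INR n * Rabs u)) with (L * l / INR n * Rabs u) by (field; nra).
      replace (L * l / INR n * (INR k / 2) + L * l / INR n / (2 * INR k) * u ^ 2)
        with (L * l / INR n * (INR k / 2 + u ^ 2 / (2 * INR k))) by (field; nra).
      apply Rmult_le_compat_l; [apply Rdiv_le_0_compat; nra|].
      apply (Rmult_le_reg_r (2 * INR k)); [lra|].
      replace ((INR k / 2 + u ^ 2 / (2 * INR k)) * (2 * INR k)) with (INR k ^ 2 + u ^ 2)
        by (field; lra).
      rewrite <- (pow2_abs u). pose proof (Rle_0_sqr (Rabs u - INR k)) as HS.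
      unfold Rsqr in HS. nra.
    - replace (INR n * (x / l) - INR n * (x / l)) with 0 by ring.
      set (t := x / l) in *.
      assert (Htt : t * (1 - t) <= 1) by nra.
      rewrite Hn.
      replace (L * l / (INR k * INR k) * (INR k / 2) +
        L * l / (INR k * INR k) / (2 * INR k) * (0 ^ 2 + INR k * INR k * (t * (1 - t))))
       with (L * l / INR k * (1 / 2 + 1 / 2 * (t * (1 - t)))) by (field; lra).
      rewrite <- (Rmult_1_r (L * l / INR k)) at 2.
      apply Rmult_le_compat_l; [apply Rdiv_le_0_compat; nra|lra]. }
  apply Rle_trans with (inner_L2 l (fun _ => L * l / INR k) (fun _ => L * l / INR k)).
  - pose proof (cont_bernstein_scaled n (fun i => g (l * INR i / INR n))).
    assert (cont h) by (unfold h; auto with cont).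
    apply inner_le; auto with cont. intros x Hx. specialize (Hh x Hx).
    apply Rsqr_le_abs_1. rewrite (Rabs_pos_eq (L * l / INR k)); [exact Hh|].
    apply Rdiv_le_0_compat; nra.
  - rewrite inner_const.
    replace (l * (L * l / INR k * (L * l / INR k))) with (C / INR k / INR k)
      by (unfold C; field; lra).
    assert (HCk : C / INR k <= eps).
    { apply (Rmult_le_reg_r (INR k)); [lra|]. apply (Rmult_lt_compat_r eps) in Hk; [|lra].
      field_simplify in Hk; [|lra]. field_simplify; lra. }
    apply Rle_trans with (C / INR k); [|exact HCk].
    assert (0 <= C / INR k) by (apply Rdiv_le_0_compat; lra).
    apply (Rmult_le_reg_r (INR k)); [lra|].
    replace (C / INR k / INR k * INR k) with (C / INR k) by (field; lra). nra.
Qed.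

(** * Decay of the remainder for smooth functions *)

(** No boundary terms arise: [phi] vanishes at both ends. *)
Lemma coef_by_parts k :
  legendre_coef l g (S k)
  = transfer l k * legendre_coef l g' k - transfer l (S k) * legendre_coef l g' (S (S k)).
Proof.
  pose proof (cont_normalized l) as Ce.
  pose proof (cont_phi l (S k)) as Cphi.
  pose proof (inner_by_parts l g g' (phi l (S k)) (normalized_legendre l (S k))
    Dg (is_derive_phi l (S k)) Cg' (Ce (S k))) as H.
  rewrite phi_0, phi_l in H by (lia || lra).
  unfold legendre_coef.
  assert (E : inner_L2 l g' (phi l (S k)) =
    transfer l (S k) * inner_L2 l g' (normalized_legendre l (S (S k)))
    + - transfer l k * inner_L2 l g' (normalized_legendre l k)).
  { rewrite <- inner_lin_r by auto. apply inner_ext; [exact hl|].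
    intros. rewrite phi_eq by exact hl. ring. }
  lra.
Qed.

Lemma transfer_sqr_le N k : (N <= k)%nat ->
  transfer l k * transfer l k <= l ^ 2 / 4 / (INR N + 1) ^ 2.
Proof.
  intros H. apply le_INR in H. pose proof (pos_INR N). unfold transfer.
  assert (0 < sqrt (2 * INR k + 1)) by (apply sqrt_lt_R0; lra).
  assert (0 < sqrt (2 * INR k + 3)) by (apply sqrt_lt_R0; lra).
  set (p := sqrt (2 * INR k + 1)) in *. set (q := sqrt (2 * INR k + 3)) in *.
  replace (l / 2 / (p * q) * (l / 2 / (p * q))) with (l ^ 2 / 4 / ((p * p) * (q * q)))
    by (field; lra).
  unfold p, q. rewrite !sqrt_sqrt by lra.
  apply Rmult_le_compat_l; [nra|]. apply Rinv_le_contravar; nra.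
Qed.

(** The block of squared coefficients of degrees [N+1, ..., M] of [g], estimated by
    the blocks of [g'] shifted by one degree down and up. *)
Lemma tail_diff N M : (N <= M)%nat ->
  tail l g (S N) - tail l g (S M) <=
  l ^ 2 / 2 / (INR N + 1) ^ 2 *
   ((tail l g' N - tail l g' M) + (tail l g' (S (S N)) - tail l g' (S (S M)))).
Proof.
  induction 1 as [|M HM IH]; [right; ring|].
  rewrite (tail_S l hl g Cg (S M)), (tail_S l hl g' Cg' M), (tail_S l hl g' Cg' (S (S M))).
  rewrite coef_by_parts.
  pose proof (transfer_sqr_le N M HM) as H1.
  pose proof (transfer_sqr_le N (S M) ltac:(lia)) as H2.
  set (D := (INR N + 1) ^ 2) in *.
  replace (l ^ 2 / 2 / D) with (2 * (l ^ 2 / 4 / D)) in *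
    by (unfold D; pose proof (pos_INR N); field; lra).
  set (Q := l ^ 2 / 4 / D) in *.
  set (s := transfer l M) in *. set (s' := transfer l (S M)) in *.
  set (c := legendre_coef l g' M). set (c' := legendre_coef l g' (S (S M))).
  pose proof (Rmult_le_compat_r (c * c) _ _ (Rle_0_sqr c) H1).
  pose proof (Rmult_le_compat_r (c' * c') _ _ (Rle_0_sqr c') H2).
  pose proof (Rle_0_sqr (s * c + s' * c')) as H3. unfold Rsqr in H3.
  assert ((s * c - s' * c') * (s * c - s' * c') <= 2 * Q * (c * c + c' * c')) by nra.
  lra.
Qed.

(** The limit [M -> infinity] of [tail_diff], where [tail_lim] kills the term
    [tail l g (S M)]. *)
Lemma tail_derive N : tail l g (S N) <= l ^ 2 / (INR N + 1) ^ 2 * tail l g' N.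
Proof.
  pose proof (pos_INR N).
  apply Rnot_lt_le. intros Hlt.
  set (eps := (tail l g (S N) - l ^ 2 / (INR N + 1) ^ 2 * tail l g' N) / 2).
  destruct (tail_lim eps) as [M HM]; [unfold eps; lra|].
  specialize (HM (S (Nat.max N M)) ltac:(lia)).
  pose proof (tail_diff N (Nat.max N M) ltac:(lia)) as HD.
  pose proof (tail_pos l hl g' Cg' (Nat.max N M)).
  pose proof (tail_pos l hl g' Cg' (S (S (Nat.max N M)))).
  pose proof (tail_decr l hl g' Cg' N (S (S N)) ltac:(lia)).
  assert (HQ : 0 <= l ^ 2 / 2 / (INR N + 1) ^ 2).
  { apply Rdiv_le_0_compat; nra. }
  unfold eps in HM. clear eps.
  replace (l ^ 2 / (INR N + 1) ^ 2) with (2 * (l ^ 2 / 2 / (INR N + 1) ^ 2)) in *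
    by (field; lra).
  set (Q := l ^ 2 / 2 / (INR N + 1) ^ 2) in *.
  assert (tail l g (S N) - tail l g (S (Nat.max N M)) <= Q * (2 * tail l g' N)).
  { eapply Rle_trans; [apply HD|]. apply Rmult_le_compat_l; lra. }
  lra.
Qed.
End Completeness.

Fixpoint globally_C (k : nat) (f : R -> R) : Prop :=
  match k with
  | O => cont f
  | S k' => exists g, (forall x, is_derive f x (g x)) /\ globally_C k' g
  end.

Lemma globally_C_cont k f : globally_C k f -> cont f.
Proof.
  destruct k as [|k]; [trivial|]. intros [f' [D _]]. exact (cont_of_derive _ _ D).
Qed.

(** Powers of [(n + 1)^2] rather than of [n^2] keep the bound meaningful at
    [n = 0]; the ratio of consecutive ones is at most [4]. *)
Lemma tail_rate l (hl : 0 < l) p : forall g, globally_C p g ->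
  exists K, 0 <= K /\ forall n, tail l g n <= K / ((INR n + 1) ^ 2) ^ p.
Proof.
  induction p as [|p IH]; intros g Hg.
  - exists (tail l g 0). split; [now apply tail_pos|]. intros n.
    simpl pow. replace (tail l g 0 / 1) with (tail l g 0) by field.
    apply tail_decr; auto. lia.
  - pose proof (globally_C_cont _ _ Hg) as Cg. destruct Hg as [g' [Dg Hg']].
    destruct (IH g' Hg') as [K [HK HT]].
    exists (tail l g 0 + l ^ 2 * K * 4 ^ (S p)).
    assert (H4 : 0 < 4 ^ S p) by (apply pow_lt; lra).
    pose proof (tail_pos l hl g Cg 0).
    assert (0 <= l ^ 2 * K * 4 ^ S p) by (repeat apply Rmult_le_pos; try apply pow_le; lra).
    split; [lra|]. intros [|N].
    + simpl INR. replace ((0 + 1) ^ 2) with 1 by ring. rewrite pow1.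
      replace ((tail l g 0 + l ^ 2 * K * 4 ^ S p) / 1) with
        (tail l g 0 + l ^ 2 * K * 4 ^ S p) by field. lra.
    + eapply Rle_trans; [apply (tail_derive l hl g g' Dg (globally_C_cont _ _ Hg'))|].
      pose proof (pos_INR N). rewrite S_INR.
      set (q := (INR N + 1) ^ 2). set (q' := (INR N + 1 + 1) ^ 2).
      assert (Hq : 0 < q) by (unfold q; nra). assert (Hq' : 0 < q') by (unfold q'; nra).
      assert (q' <= 4 * q) by (unfold q, q'; nra).
      assert (Hpow : q' ^ S p <= 4 ^ S p * q ^ S p).
      { rewrite <- Rpow_mult_distr. apply pow_incr. lra. }
      assert (0 < q ^ S p) by (apply pow_lt; lra).
      assert (0 < q' ^ S p) by (apply pow_lt; lra).
      apply Rle_trans with (l ^ 2 * K / q ^ S p).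
      * replace (l ^ 2 * K / q ^ S p) with (l ^ 2 / q * (K / q ^ p)).
        2:{ simpl. assert (0 < q ^ p) by (apply pow_lt; lra). field. lra. }
        apply Rmult_le_compat_l; [|apply HT].
        apply Rdiv_le_0_compat; [apply pow2_ge_0|exact Hq].
      * apply Rle_trans with (l ^ 2 * K * 4 ^ S p / q' ^ S p).
        -- replace (l ^ 2 * K / q ^ S p) with (l ^ 2 * K * 4 ^ S p * / (4 ^ S p * q ^ S p))
             by (field; lra).
           apply Rmult_le_compat_l; [lra|]. apply Rinv_le_contravar; lra.
        -- apply Rmult_le_compat_r; [left; apply Rinv_0_lt_compat; lra|lra].
Qed.

(** * Extension from the interval to the line *)

Section Extension.
Variable l : R.
Hypothesis hl : 0 < l.

Definition clamp (x : R) : R := Rmax 0 (Rmin x l).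

Lemma clamp_segm x : segm l (clamp x).
Proof. unfold segm, clamp, Rmax, Rmin. repeat destruct Rle_dec; lra. Qed.

Lemma clamp_id x : segm l x -> clamp x = x.
Proof. unfold segm, clamp, Rmax, Rmin. repeat destruct Rle_dec; lra. Qed.

Lemma clamp_contract x y : Rabs (clamp x - clamp y) <= Rabs (x - y).
Proof.
  unfold clamp, Rmax, Rmin, Rabs.
  repeat destruct Rle_dec; repeat destruct Rcase_abs; lra.
Qed.

Lemma cont_clamp f : continuous_on_segm l f -> cont (fun x => f (clamp x)).
Proof.
  intros Hf x. apply continuity_pt_filterlim. intros eps He.
  destruct (Hf (clamp x) (clamp_segm x) eps He) as [d [Hd H]].
  exists d. split; [exact Hd|]. intros y [_ Hy].
  destruct (Req_dec (clamp x) (clamp y)) as [E|Hne].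
  - simpl. unfold Rdist. rewrite E, Rminus_diag, Rabs_R0. exact He.
  - apply (H (clamp y)). split; [split; [apply clamp_segm|exact Hne]|].
    eapply Rle_lt_trans; [apply clamp_contract|exact Hy].
Qed.

Lemma segm_interior x : 0 < x < l -> locally x (segm l).
Proof.
  intros Hx. exists (mkposreal (Rmin x (l - x)) ltac:(apply Rmin_pos; lra)).
  intros y Hy. apply Rabs_lt_between' in Hy. simpl in Hy.
  pose proof (Rmin_l x (l - x)). pose proof (Rmin_r x (l - x)).
  unfold segm. lra.
Qed.

Lemma is_derive_interior f g x :
  is_derivative_on_segm l f g -> 0 < x < l -> is_derive f x (g x).
Proof.
  intros H Hx. apply is_derive_Reals. intros eps He.
  destruct (H x ltac:(unfold segm; lra) eps He) as [d [Hd Hlim]].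
  destruct (segm_interior x Hx) as [d' Hd'].
  exists (mkposreal (Rmin d d') (Rmin_pos _ _ Hd (cond_pos d'))).
  simpl. intros h Hh Hlt.
  pose proof (Rmin_l d d'). pose proof (Rmin_r d d').
  assert (E : x + h - x = h) by ring.
  specialize (Hlim (x + h)). simpl in Hlim. unfold Rdist in Hlim. rewrite E in Hlim.
  apply Hlim. split; [split|]; [| |lra].
  - apply Hd'. unfold ball; simpl. unfold AbsRing_ball, abs, minus, plus, opp; simpl.
    replace (x + h + - x) with h by ring. lra.
  - lra.
Qed.

Lemma is_derive_agree (f F : R -> R) (g G x : R) :
  (forall y, 0 < y < l -> f y = F y) -> 0 < x < l ->
  is_derive f x g -> is_derive F x G -> g = G.
Proof.
  intros Heq Hx Df DF. apply is_derive_unique in Df. rewrite <- Df.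
  apply is_derive_unique. apply (is_derive_ext_loc F); [|exact DF].
  exists (mkposreal (Rmin x (l - x)) ltac:(apply Rmin_pos; lra)).
  intros y Hy. apply Rabs_lt_between' in Hy. simpl in Hy.
  pose proof (Rmin_l x (l - x)). pose proof (Rmin_r x (l - x)).
  symmetry. apply Heq. lra.
Qed.

(** The mean value theorem for the difference of both sides.  It is applied to
    [f] composed with [clamp], which is continuous on the line although [f] is
    only known to be continuous relative to the interval. *)
Lemma antiderivative_agree f g G :
  is_derivative_on_segm l f g -> cont G -> (forall x, segm l x -> G x = g x) ->
  forall x, segm l x -> f 0 + RInt G 0 x = f x.
Proof.
  intros Df CG Hg x Hx.
  pose proof (fun y => is_derive_antiderivative G (f 0) y CG) as DF.
  assert (Cf : cont (fun y => f (clamp y))).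
  { apply cont_clamp. intros y Hy. apply (cont_deriv _ _ _ _ (Df y Hy)). }
  destruct (MVT_gen (fun y => f (clamp y) - (f 0 + RInt G 0 y)) 0 x (fun y => g y - G y))
    as [c [Hc E]].
  - rewrite Rmin_left, Rmax_right by (destruct Hx; lra). intros y Hy.
    apply (is_derive_minus (fun y => f (clamp y)) (fun y => f 0 + RInt G 0 y)); [|apply DF].
    assert (Hyl : 0 < y < l) by (destruct Hx; lra).
    apply (is_derive_ext_loc f); [|now apply is_derive_interior].
    apply (filter_imp (segm l)); [|now apply segm_interior].
    intros z Hz. now rewrite clamp_id.
  - intros y _. apply continuity_pt_filterlim.
    apply (cont_minus (fun y => f (clamp y)) _ Cf (cont_of_derive _ _ DF)).
  - rewrite Rmin_left, Rmax_right in Hc by (destruct Hx; lra).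
    rewrite Hg, !clamp_id in E by (unfold segm in *; lra).
    rewrite (RInt_point (V := R_CompleteNormedModule)) in E.
    change (@zero R_CompleteNormedModule) with 0 in E. lra.
Qed.

Lemma of_class_C_extend k : forall f, of_class_C l k f ->
  exists F, (forall x, segm l x -> F x = f x) /\ globally_C k F.
Proof.
  induction k as [|k IH]; intros f Hf.
  - exists (fun x => f (clamp x)). split; [|now apply cont_clamp].
    intros x Hx. now rewrite clamp_id.
  - destruct Hf as [g [Df Hg]]. destruct (IH g Hg) as [G [HG CG]].
    exists (fun x => f 0 + RInt G 0 x).
    pose proof (globally_C_cont _ _ CG) as CG0.
    split; [now apply (antiderivative_agree f g G)|].
    exists G. split; [|exact CG]. intros y. now apply is_derive_antiderivative.
Qed.
End Extension.

(** * The Galerkin error *)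

Section Galerkin.
Variable l : R.
Hypothesis hl : 0 < l.

(** Integrating [u^2] against the derivative of [x - l] leaves no boundary term,
    as [u] vanishes at [0] and [x - l] at [l]; the remaining product
    [2 (l - x) u u'] is at most [u^2 / 2 + 2 l^2 u'^2]. *)
Lemma poincare (u u' : R -> R) : (forall x, is_derive u x (u' x)) -> cont u' -> u 0 = 0 ->
  inner_L2 l u u <= 4 * l ^ 2 * inner_L2 l u' u'.
Proof.
  intros Du Cu' H0. pose proof (cont_of_derive _ _ Du) as Cu.
  assert (Duu : forall x, is_derive (fun x => u x * u x) x (u' x * u x + u x * u' x)).
  { intros x. apply (is_derive_mult (K := R_AbsRing) u u); auto. intros; apply Rmult_comm. }
  assert (Dx : forall x, is_derive (fun x => x - l) x 1).
  { intros x. auto_derive; [trivial|ring]. }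
  pose proof (inner_by_parts l (fun x => u x * u x) (fun x => u' x * u x + u x * u' x)
    (fun x => x - l) (fun _ => 1) Duu Dx ltac:(auto with cont) ltac:(auto with cont)) as HI.
  cbv beta in HI. rewrite H0 in HI.
  rewrite (inner_ext l hl (fun x => u x * u x) (fun _ => 1) u u) in HI by (intros; ring).
  assert (HB : inner_L2 l (fun x => - (u' x * u x + u x * u' x)) (fun x => x - l) <=
     inner_L2 l (fun x => / 2 * (u x * u x) + 2 * l ^ 2 * (u' x * u' x)) (fun _ => 1)).
  { assert (cont (fun x => - (u' x * u x + u x * u' x))).
    { apply (cont_ext (fun x => 0 - (u' x * u x + u x * u' x))); [intros; ring|].
      auto with cont. }
    apply inner_le; auto 10 with cont.
    intros x Hx.
    pose proof (Rle_0_sqr (u x + 2 * (x - l) * u' x)) as HS. unfold Rsqr in HS.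
    assert ((x - l) * (x - l) <= l ^ 2) by nra.
    pose proof (Rmult_le_compat_r (u' x * u' x) _ _ (Rle_0_sqr (u' x)) H1). nra. }
  rewrite inner_lin in HB by auto with cont.
  rewrite (inner_ext l hl (fun x => u x * u x) (fun _ => 1) u u) in HB by (intros; ring).
  rewrite (inner_ext l hl (fun x => u' x * u' x) (fun _ => 1) u' u') in HB by (intros; ring).
  rewrite (inner_ext l hl _ (fun x => x - l)
    (fun x => -1 * (u' x * u x + u x * u' x) + 0 * 0) (fun x => x - l)) in HB by (intros; ring).
  rewrite inner_lin in HB by auto with cont. lra.
Qed.

Definition galerkin_sum' (N : nat) (alpha : nat -> R) (x : R) : R :=
  sum_n_m (fun m => alpha m * normalized_legendre l m x) 1 N.

Lemma galerkin_sum_0 alpha x : galerkin_sum l 0 alpha x = 0.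
Proof. unfold galerkin_sum. now rewrite sum_n_m_zero by lia. Qed.

Lemma galerkin_sum'_0 alpha x : galerkin_sum' 0 alpha x = 0.
Proof. unfold galerkin_sum'. now rewrite sum_n_m_zero by lia. Qed.

Lemma galerkin_sum_S N alpha x : galerkin_sum l (S N) alpha x
  = 1 * galerkin_sum l N alpha x + alpha (S N) * phi l (S N) x.
Proof.
  unfold galerkin_sum. rewrite sum_n_Sm by lia. rewrite Rmult_1_l. reflexivity.
Qed.

Lemma galerkin_sum'_S N alpha x : galerkin_sum' (S N) alpha x
  = 1 * galerkin_sum' N alpha x + alpha (S N) * normalized_legendre l (S N) x.
Proof.
  unfold galerkin_sum'. rewrite sum_n_Sm by lia. rewrite Rmult_1_l. reflexivity.
Qed.

Lemma is_derive_galerkin_sum N alpha x :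
  is_derive (galerkin_sum l N alpha) x (galerkin_sum' N alpha x).
Proof.
  induction N as [|N IH].
  - rewrite galerkin_sum'_0. apply (is_derive_ext (fun _ => 0)).
    + intros t. symmetry. apply galerkin_sum_0.
    + apply (is_derive_const (K := R_AbsRing) (V := R_NormedModule)).
  - rewrite galerkin_sum'_S.
    apply (is_derive_ext
      (fun x => 1 * galerkin_sum l N alpha x + alpha (S N) * phi l (S N) x)).
    { intros t. symmetry. apply galerkin_sum_S. }
    apply (is_derive_plus (fun x => 1 * galerkin_sum l N alpha x)
      (fun x => alpha (S N) * phi l (S N) x)).
    + apply (is_derive_scal (galerkin_sum l N alpha)), IH.
    + apply (is_derive_scal (phi l (S N))), is_derive_phi.
Qed.

Lemma cont_galerkin_sum N alpha : cont (galerkin_sum l N alpha).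
Proof. eapply cont_of_derive, is_derive_galerkin_sum. Qed.

Lemma cont_galerkin_sum' N alpha : cont (galerkin_sum' N alpha).
Proof.
  induction N as [|N IH].
  - apply (cont_ext (fun _ => 0)); [|apply cont_const].
    intros; symmetry; apply galerkin_sum'_0.
  - pose proof (cont_normalized l (S N)). eapply cont_ext.
    + intros x. symmetry. apply galerkin_sum'_S.
    + cbv beta. auto with cont.
Qed.

Lemma galerkin_sum_minus N alpha beta x :
  galerkin_sum l N (fun m => beta m - alpha m) x
  = galerkin_sum l N beta x - galerkin_sum l N alpha x.
Proof.
  induction N as [|N IH]; [rewrite !galerkin_sum_0; ring|].
  rewrite !galerkin_sum_S, IH. ring.
Qed.

Lemma galerkin_sum'_minus N alpha beta x :
  galerkin_sum' N (fun m => beta m - alpha m) x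
  = galerkin_sum' N beta x - galerkin_sum' N alpha x.
Proof.
  induction N as [|N IH]; [rewrite !galerkin_sum'_0; ring|].
  rewrite !galerkin_sum'_S, IH. ring.
Qed.

Lemma galerkin_sum_at_0 N alpha : galerkin_sum l N alpha 0 = 0.
Proof.
  induction N as [|N IH]; [apply galerkin_sum_0|].
  rewrite galerkin_sum_S, IH, phi_0. ring.
Qed.

Lemma orthogonal_galerkin_sum a b u u' N beta : cont u -> cont u' ->
  (forall m, (1 <= m <= N)%nat ->
     b * inner_L2 l u' (normalized_legendre l m) + a * inner_L2 l u (phi l m) = 0) ->
  b * inner_L2 l u' (galerkin_sum' N beta) + a * inner_L2 l u (galerkin_sum l N beta) = 0.
Proof.
  intros Cu Cu'. induction N as [|N IH]; intros H.
  - rewrite (inner_ext l hl u' _ (fun _ => 0) (fun _ => 0))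
      by (intros; rewrite galerkin_sum'_0; ring).
    rewrite (inner_ext l hl u _ (fun _ => 0) (fun _ => 0))
      by (intros; rewrite galerkin_sum_0; ring).
    rewrite inner_const. ring.
  - rewrite (inner_ext l hl u' _ u' (fun x =>
      1 * galerkin_sum' N beta x + beta (S N) * normalized_legendre l (S N) x))
      by (intros; now rewrite galerkin_sum'_S).
    rewrite (inner_ext l hl u _ u (fun x =>
      1 * galerkin_sum l N beta x + beta (S N) * phi l (S N) x))
      by (intros; now rewrite galerkin_sum_S).
    rewrite !inner_lin_r by auto using cont_galerkin_sum, cont_galerkin_sum',
      cont_normalized, cont_phi.
    pose proof (IH ltac:(intros; apply H; lia)).
    pose proof (H (S N) ltac:(lia)) as HN.
    apply (Rmult_eq_compat_l (beta (S N))) in HN. lra.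
Qed.

Variables (a b : R) (f W G G' : R -> R).
Hypothesis ha : 0 < a.
Hypothesis hb : 0 < b.
Hypothesis DW : forall x, is_derive W x (G x).
Hypothesis DG : forall x, is_derive G x (G' x).
Hypothesis CG' : cont G'.
Hypothesis W0 : W 0 = 0.
Hypothesis Wl : W l = 0.
Hypothesis ode : forall x, 0 < x < l -> a * W x - b * G' x = f x.

Let CW : cont W := cont_of_derive _ _ DW.
Let CG : cont G := cont_of_derive _ _ DG.

Lemma weak_form m : (1 <= m)%nat ->
  b * inner_L2 l G (normalized_legendre l m) + a * inner_L2 l W (phi l m)
  = inner_L2 l f (phi l m).
Proof.
  intros Hm. pose proof (cont_phi l m). pose proof (cont_normalized l m).
  rewrite (inner_ext l hl f _ (fun x => a * W x + - b * G' x) (phi l m))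
    by (intros x Hx; rewrite <- (ode x Hx); ring).
  rewrite inner_lin by assumption.
  pose proof (inner_by_parts l G G' _ _ DG (is_derive_phi l m) CG' (cont_normalized l m)) as HI.
  rewrite phi_0, phi_l in HI by (lia || lra).
  replace (inner_L2 l G (normalized_legendre l m)) with (- inner_L2 l G' (phi l m)) by lra.
  ring.
Qed.

Lemma galerkin_orthogonality N alpha m :
  solves_ritz_galerkin l a b f N alpha -> (1 <= m <= N)%nat ->
  b * inner_L2 l (fun x => galerkin_sum' N alpha x - G x) (normalized_legendre l m)
  + a * inner_L2 l (fun x => galerkin_sum l N alpha x - W x) (phi l m) = 0.
Proof.
  intros Hs Hm. specialize (Hs m Hm). rewrite <- weak_form in Hs by lia.
  pose proof (cont_phi l m). pose proof (cont_normalized l m).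
  pose proof (cont_galerkin_sum N alpha). pose proof (cont_galerkin_sum' N alpha).
  rewrite (inner_ext l hl _ _ (galerkin_sum' N alpha) (normalized_legendre l m)) in Hs.
  2:{ intros x _. f_equal; apply is_derive_unique.
      - apply is_derive_galerkin_sum.
      - apply is_derive_phi. }
  rewrite (inner_ext l hl (fun x => galerkin_sum' N alpha x - G x) _
    (fun x => 1 * galerkin_sum' N alpha x + - (1) * G x)
    (normalized_legendre l m)) by (intros; ring).
  rewrite (inner_ext l hl (fun x => galerkin_sum l N alpha x - W x) _
    (fun x => 1 * galerkin_sum l N alpha x + - (1) * W x)
    (phi l m)) by (intros; ring).
  rewrite !inner_lin by assumption. lra.
Qed.

(** With [u] the difference of the two elements of the trial space, [d = e + u]
    and the cross terms in the energy of [d] vanish by Galerkin orthogonality. *)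
Lemma galerkin_quasi_optimal N alpha beta :
  solves_ritz_galerkin l a b f N alpha ->
  let e x := galerkin_sum l N alpha x - W x in
  let d x := galerkin_sum l N beta x - W x in
  let d' x := galerkin_sum' N beta x - G x in
  a * inner_L2 l e e <= b * inner_L2 l d' d' + a * inner_L2 l d d.
Proof.
  intros Hs e d d'.
  pose (e' := fun x => galerkin_sum' N alpha x - G x).
  pose (u := galerkin_sum l N (fun m => beta m - alpha m)).
  pose (u' := galerkin_sum' N (fun m => beta m - alpha m)).
  pose proof (cont_galerkin_sum N alpha). pose proof (cont_galerkin_sum' N alpha).
  assert (Ce : cont e) by (unfold e; auto with cont).
  assert (Ce' : cont e') by (unfold e'; auto with cont).
  assert (Cu : cont u) by apply cont_galerkin_sum.
  assert (Cu' : cont u') by apply cont_galerkin_sum'.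
  pose proof (orthogonal_galerkin_sum a b e e' N (fun m => beta m - alpha m) Ce Ce'
    (fun m Hm => galerkin_orthogonality N alpha m Hs Hm)) as Horth.
  fold u u' in Horth.
  assert (Hsq : forall v z z', cont z -> cont z' ->
     (forall x, v x = 1 * z x + 1 * z' x) ->
     inner_L2 l v v = inner_L2 l z z + 2 * inner_L2 l z z' + inner_L2 l z' z').
  { intros v z z' Hz Hz' Hv.
    rewrite (inner_ext l hl v v (fun x => 1 * z x + 1 * z' x) (fun x => 1 * z x + 1 * z' x))
      by (intros; now rewrite !Hv).
    rewrite inner_lin, !inner_lin_r, (inner_comm l hl z' z) by auto with cont. ring. }
  rewrite (Hsq d e u Ce Cu), (Hsq d' e' u' Ce' Cu').
  - pose proof (inner_pos l hl u Cu). pose proof (inner_pos l hl u' Cu').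
    pose proof (inner_pos l hl e' Ce'). nra.
  - intros x. unfold d', e', u'. rewrite galerkin_sum'_minus. ring.
  - intros x. unfold d, e, u. rewrite galerkin_sum_minus. ring.
Qed.

(** The mean of [G] is [(W l - W 0) / l]. *)
Lemma legendre_coef_0 : legendre_coef l G 0 = 0.
Proof.
  unfold legendre_coef. rewrite inner_normalized by assumption.
  rewrite (inner_ext l hl G _ G (fun _ => 1))
    by (intros; unfold shifted_legendre; reflexivity).
  pose proof (inner_by_parts l W G (fun _ => 1) (fun _ => 0) DW
    (fun x => is_derive_const (K := R_AbsRing) (V := R_NormedModule) 1 x)
    CG (cont_const 0)) as HI.
  rewrite (inner_ext l hl W _ (fun _ => 0) (fun _ => 0)), inner_const in HI by (intros; ring).
  rewrite W0, Wl in HI.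
  replace (inner_L2 l G (fun _ => 1)) with 0 by lra. ring.
Qed.

(** As [G] has no component of degree [0], the sum over the degrees [1, ..., N] is
    its full projection. *)
Lemma galerkin_sum'_projection N x :
  galerkin_sum' N (legendre_coef l G) x - G x = - remainder l G (S N) x.
Proof.
  induction N as [|N IH].
  - rewrite galerkin_sum'_0. simpl. rewrite legendre_coef_0. ring.
  - rewrite galerkin_sum'_S.
    change (remainder l G (S (S N)) x) with (remainder l G (S N) x
      - legendre_coef l G (S N) * normalized_legendre l (S N) x).
    lra.
Qed.

Lemma galerkin_error N alpha :
  solves_ritz_galerkin l a b f N alpha ->
  inner_L2 l (fun x => galerkin_sum l N alpha x - W x)
             (fun x => galerkin_sum l N alpha x - W x)
  <= (b / a + 4 * l ^ 2) * tail l G (S N).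
Proof.
  intros Hs.
  pose proof (galerkin_quasi_optimal N alpha (legendre_coef l G) Hs) as HQ. cbv zeta in HQ.
  set (e := inner_L2 l (fun x => galerkin_sum l N alpha x - W x) _) in *.
  set (beta := legendre_coef l G) in *.
  pose proof (cont_galerkin_sum' N beta).
  pose proof (poincare (fun x => galerkin_sum l N beta x - W x)
    (fun x => galerkin_sum' N beta x - G x)) as HP.
  rewrite (inner_ext l hl (fun x => galerkin_sum' N beta x - G x) _
    (remainder l G (S N)) (remainder l G (S N))) in HQ, HP
    by (intros; unfold beta; rewrite galerkin_sum'_projection; ring).
  fold (tail l G (S N)) in HQ, HP.
  apply (Rmult_le_reg_l a); [exact ha|].
  replace (a * ((b / a + 4 * l ^ 2) * tail l G (S N))) with
    (b * tail l G (S N) + a * (4 * l ^ 2 * tail l G (S N))) by (field; lra).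
  eapply Rle_trans; [exact HQ|]. apply Rplus_le_compat_l, Rmult_le_compat_l; [lra|].
  apply HP.
  - intros x. apply (is_derive_minus (galerkin_sum l N beta) W);
      [apply is_derive_galerkin_sum|apply DW].
  - auto with cont.
  - rewrite galerkin_sum_at_0, W0. ring.
Qed.
End Galerkin.

Theorem theorem7p7 (l a b : R) (f w : R -> R) (p : nat)
  (hl : 0 < l) (ha : 0 < a) (hb : 0 < b)
  (hf : continuous_on_segm l f)
  (hw : solves_bvp l a b f w)
  (hp : (1 <= p)%nat)
  (hreg : of_class_C l (p + 1) w) :
  exists c : R, 0 < c /\
    forall (N : nat) (alpha : nat -> R),
      (1 <= N)%nat ->
      solves_ritz_galerkin l a b f N alpha ->
      norm_L2 l (fun x => galerkin_sum l N alpha x - w x)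
        <= c / Rpower (INR N) (INR p - 1 / 2).
Proof.
  destruct hw as [[w1 [w2 [Dw [Dw1 Hode]]]] [w0 wl]].
  replace (p + 1)%nat with (S p) in hreg by lia.
  destruct (of_class_C_extend l hl (S p) w hreg) as [W [HW [G [DW HG]]]].
  destruct (tail_rate l hl p G HG) as [K [HK Htail]].
  destruct p as [|q]; [lia|]. destruct HG as [G' [DG HG']].
  pose proof (globally_C_cont _ _ HG') as CG'.
  assert (E1 : forall x, 0 < x < l -> w1 x = G x).
  { intros x Hx. apply (is_derive_agree l w W (w1 x) (G x) x); auto.
    - intros y Hy. symmetry. apply HW. unfold segm. lra.
    - now apply (is_derive_interior l). }
  assert (E2 : forall x, 0 < x < l -> w2 x = G' x).
  { intros x Hx. apply (is_derive_agree l w1 G (w2 x) (G' x) x); auto.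
    now apply (is_derive_interior l). }
  assert (ode : forall x, 0 < x < l -> a * W x - b * G' x = f x).
  { intros x Hx. rewrite <- E2, HW by (auto || (unfold segm; lra)).
    apply Hode. unfold segm. lra. }
  rewrite <- HW in w0, wl by (unfold segm; lra).
  set (A := b / a + 4 * l ^ 2).
  assert (HA : 0 <= A).
  { unfold A. pose proof (Rdiv_lt_0_compat b a hb ha). pose proof (pow2_ge_0 l). lra. }
  exists (sqrt (A * K) + 1). split; [pose proof (sqrt_pos (A * K)); lra|].
  intros N alpha HN Hs.
  pose proof (galerkin_error l hl a b f W G G' ha hb DW DG CG' w0 wl ode N alpha Hs) as Herr.
  fold A in Herr.
  assert (HN1 : 1 <= INR N) by (apply le_INR in HN; exact HN).
  set (P := INR N ^ S q).
  assert (HP : 0 < P) by (apply pow_lt; lra).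
  assert (HRP : 0 < Rpower (INR N) (INR (S q) - 1 / 2)) by apply exp_pos.
  assert (Hpow : Rpower (INR N) (INR (S q) - 1 / 2) <= P).
  { unfold P. rewrite <- Rpower_pow by lra. apply Rle_Rpower; lra. }
  assert (Hsq : norm_L2 l (fun x => galerkin_sum l N alpha x - w x) <= sqrt (A * K) / P).
  { unfold norm_L2.
    rewrite (inner_ext l hl _ _ (fun x => galerkin_sum l N alpha x - W x)
      (fun x => galerkin_sum l N alpha x - W x))
      by (intros; rewrite HW by (unfold segm; lra); reflexivity).
    replace (sqrt (A * K) / P) with (sqrt (A * K / (P * P))).
    2:{ rewrite sqrt_div, sqrt_square by nra. reflexivity. }
    apply sqrt_le_1_alt. eapply Rle_trans; [exact Herr|].
    unfold Rdiv. rewrite Rmult_assoc. apply Rmult_le_compat_l; [exact HA|].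
    eapply Rle_trans; [apply Htail|].
    apply Rmult_le_compat_l; [exact HK|]. apply Rinv_le_contravar; [nra|].
    unfold P. rewrite <- Rpow_mult_distr. apply pow_incr. rewrite S_INR. nra. }
  eapply Rle_trans; [exact Hsq|].
  pose proof (sqrt_pos (A * K)).
  apply Rle_trans with (sqrt (A * K) / Rpower (INR N) (INR (S q) - 1 / 2)).
  - apply Rmult_le_compat_l; [lra|]. now apply Rinv_le_contravar.
  - apply Rmult_le_compat_r; [|lra]. left. now apply Rinv_0_lt_compat.
Qed.
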